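(* Let $0<q<1$ and let $f(x)=\big(\Gamma_q(x+1)\big)^{\frac{1}{x}}$ for $x>0$. Then the function $F(x)=\frac{f(x)}{x}$ is strictly decreasing and strictly log-convex on $(0,\infty)$.
   Context: For $0<q<1$ and complex $a$, $(a;q)_\infty=\prod_{i=0}^{\infty}(1-aq^i)$. For real $x>0$, the $q$-gamma function is $\Gamma_q(x)=\frac{(q;q)_\infty}{(q^x;q)_\infty}(1-q)^{1-x}$. A positive function is strictly log-convex if its logarithm is strictly convex. *)

(* Defs.v *)
(* Stdlib reals with Coquelicot. *)
From Stdlib Require Export Reals.
From Coquelicot Require Export Coquelicot.
Open Scope R_scope.

(* Only real arguments [a] occur in the q-gamma function, so the product is
   taken in [R].  [prod_f_R0 u n] has the [n + 1] factors [u 0], ..., [u n].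
   [Lim_seq] is a junk value when there is no limit; for [0 < q < 1] the
   partial products converge to a finite limit for every [a]. *)
Definition q_pochhammer_inf (a q : R) : R :=
  real (Lim_seq (prod_f_R0 (fun i : nat => 1 - a * q ^ i))).

(* [Rpower b y] is [exp (y * ln b)], hence the usual real power for [0 < b]. *)
Definition q_Gamma (q x : R) : R :=
  q_pochhammer_inf q q / q_pochhammer_inf (Rpower q x) q
  * Rpower (1 - q) (1 - x).

Definition strictly_decreasing_on (D : R -> Prop) (g : R -> R) : Prop :=
  forall x y : R, D x -> D y -> x < y -> g y < g x.

Definition strictly_convex_on (D : R -> Prop) (g : R -> R) : Prop :=
  forall x y t : R, D x -> D y -> x <> y -> 0 < t < 1 ->
    g (t * x + (1 - t) * y) < t * g x + (1 - t) * g y.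

Definition strictly_log_convex_on (D : R -> Prop) (g : R -> R) : Prop :=
  (forall x : R, D x -> 0 < g x) /\
  strictly_convex_on D (fun x : R => ln (g x)).

(* Main.v *)
Require Import Defs.
From Stdlib Require Import Reals Lra Psatz.
From Coquelicot Require Import Coquelicot.
Open Scope R_scope.

(** Put [g x = ln (q_Gamma q (x + 1))], so that [ln (F x) = g x / x - ln x].
    The numerator [n] of [x ^ 3] times the second derivative of
    [G x / x - k * ln x] telescopes when it is differentiated once more:
    [n' x = x ^ 2 * G''' x + k].  As [n 0 = 0] when [G 0 = 0], strict convexity
    follows from the single inequality [0 < x ^ 2 * G''' x + k]
    ([strictly_convex_quotient]).

    For [G = g] and [k = 1] the inequality to prove is [- g''' x < 1 / x ^ 2].
    The product for the q-gamma function writes [- g'''] as a series over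
    [m = 1, 2, 3] and so on, whose terms are at most [2 / (x + m) ^ 3], the
    corresponding terms for the classical gamma function.  With
    [v = - (x + m) * ln q / 2] this is the classical inequality
    [cosh v <= (sinh v / v) ^ 3] ([Lazarevic_inequality]).  The cubes sum to at
    most [1 / (x + 1/2) ^ 2] by a midpoint telescoping
    ([sum_inverse_cubes_bound]), which is less than [1 / x ^ 2].

    Series are never differentiated: the argument runs on the partial products,
    and convexity passes to the limit.  To keep it strict, [ln (1 + x) / 4] is
    subtracted from every partial sum.  The gap between [1 / x ^ 2] and
    [1 / (x + 1/2) ^ 2] pays for it ([log_q_Gamma_partial_convex]), and it is
    given back after the limit, because [ln (1 + x) / (4 * x)] is itself
    strictly convex ([strictly_convex_of_limit]).

    Monotonicity then follows from convexity and an upper bound.  Up to a power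
    of [1 - q], the product for [q_Gamma q (x + 1)] has the factors
    [(1 - q ^ m) / (1 - q ^ (x + m))], all at most [1]; so
    [g x / x <= - ln (1 - q)] and [ln (F x)] tends to minus infinity; a
    strictly convex function with that behaviour is strictly decreasing
    ([strictly_decreasing_of_convex_to_minus_infinity]). *)

(** * Convexity on the positive half-line *)

Lemma convex_of_increasing_derivative (h h1 : R -> R) :
  (forall x, 0 < x -> is_derive h x (h1 x)) ->
  (forall x y, 0 < x -> x < y -> h1 x < h1 y) ->
  strictly_convex_on (fun x => 0 < x) h.
Proof.
  intros Hd Hi.
  assert (chord : forall x y t, 0 < x -> x < y -> 0 < t < 1 ->
    h (t * x + (1 - t) * y) < t * h x + (1 - t) * h y).
  { intros x y t Hx Hxy Ht.
    set (z := t * x + (1 - t) * y).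
    assert (Hz1 : z - x = (1 - t) * (y - x)) by (unfold z; ring).
    assert (Hz2 : y - z = t * (y - x)) by (unfold z; ring).
    assert (x < z) by nra. assert (z < y) by nra.
    destruct (MVT_cor2 h h1 x z) as [c [Hc Hc']]; [assumption| |].
    { intros c Hc. apply is_derive_Reals, Hd. lra. }
    destruct (MVT_cor2 h h1 z y) as [d [He He']]; [assumption| |].
    { intros d He. apply is_derive_Reals, Hd. lra. }
    rewrite Hz1 in Hc. rewrite Hz2 in He.
    assert (Hcd : h1 c < h1 d) by (apply Hi; lra).
    assert (0 < t * (1 - t) * (y - x)) by (apply Rmult_lt_0_compat; nra).
    assert (h1 c * (t * (1 - t) * (y - x)) < h1 d * (t * (1 - t) * (y - x)))
      by (apply Rmult_lt_compat_r; assumption).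
    assert (t * h x + (1 - t) * h y - h z
      = h1 d * (t * (1 - t) * (y - x)) - h1 c * (t * (1 - t) * (y - x))).
    { replace (h x) with (h z - h1 c * ((1 - t) * (y - x))) by lra.
      replace (h y) with (h z + h1 d * (t * (y - x))) by lra. ring. }
    lra. }
  intros x y t Hx Hy Hne Ht.
  destruct (Rtotal_order x y) as [H|[H|H]]; [auto|contradiction|].
  specialize (chord y x (1 - t) Hy H).
  replace (t * x + (1 - t) * y) with ((1 - t) * y + (1 - (1 - t)) * x) by ring.
  lra.
Qed.

(** The second derivative is [n x / x ^ 3] with
    [n x = x ^ 2 * G2 x - 2 * x * G1 x + 2 * G x + k * x], and [n] increases from
    [n 0 = 0].  Starting at [0] is why [G] has to be smooth up to [0]. *)
Lemma strictly_convex_quotient (G G1 G2 G3 : R -> R) (k : R) :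
  (forall x, 0 <= x -> is_derive G x (G1 x)) ->
  (forall x, 0 <= x -> is_derive G1 x (G2 x)) ->
  (forall x, 0 <= x -> is_derive G2 x (G3 x)) ->
  G 0 = 0 ->
  (forall x, 0 < x -> 0 < x ^ 2 * G3 x + k) ->
  strictly_convex_on (fun x => 0 < x) (fun x => G x / x - k * ln x).
Proof.
  intros D0 D1 D2 HG0 Hpos.
  assert (E0 : forall x, 0 <= x -> Derive (fun y => G y) x = G1 x)
    by (intros; apply is_derive_unique, D0; assumption).
  assert (E1 : forall x, 0 <= x -> Derive (fun y => G1 y) x = G2 x)
    by (intros; apply is_derive_unique, D1; assumption).
  assert (E2 : forall x, 0 <= x -> Derive (fun y => G2 y) x = G3 x)
    by (intros; apply is_derive_unique, D2; assumption).
  set (n := fun x => x ^ 2 * G2 x - 2 * x * G1 x + 2 * G x + k * x).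
  assert (Dn : forall x, 0 <= x -> is_derive n x (x ^ 2 * G3 x + k)).
  { intros x Hx. unfold n. auto_derive.
    - repeat split; eexists; eauto.
    - rewrite (E0 x Hx), (E1 x Hx), (E2 x Hx). ring. }
  assert (npos : forall x, 0 < x -> 0 < n x).
  { intros x Hx.
    destruct (MVT_cor2 n (fun y => y ^ 2 * G3 y + k) 0 x Hx) as [c [Hc Hc']].
    { intros c Hc. apply is_derive_Reals, Dn. lra. }
    assert (n 0 = 0) by (unfold n; rewrite HG0; ring).
    assert (0 < c ^ 2 * G3 c + k) by (apply Hpos; lra).
    nra. }
  set (h1 := fun x => (x * G1 x - G x) / x ^ 2 - k / x).
  assert (Dh1 : forall x, 0 < x -> is_derive h1 x (n x / x ^ 3)).
  { intros x Hx. assert (Hx' : 0 <= x) by lra. unfold h1, n. auto_derive.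
    - repeat split; try (eexists; eauto); nra.
    - rewrite (E0 x Hx'), (E1 x Hx'). field. lra. }
  apply (convex_of_increasing_derivative _ h1).
  - intros x Hx. assert (Hx' : 0 <= x) by lra. unfold h1. auto_derive.
    + repeat split; try (eexists; eauto); lra.
    + rewrite (E0 x Hx'). field. lra.
  - intros x y Hx Hxy.
    destruct (MVT_cor2 h1 (fun z => n z / z ^ 3) x y Hxy) as [c [Hc Hc']].
    { intros c Hc. apply is_derive_Reals, Dh1. lra. }
    assert (0 < n c / c ^ 3).
    { apply Rdiv_lt_0_compat; [apply npos; lra | apply pow_lt; lra]. }
    nra.
Qed.

(** If [h x <= h y] for some [x < y], then convexity keeps [h] above [h y] to the
    right of [y], which the upper bound forbids far enough out. *)
Lemma strictly_decreasing_of_convex_to_minus_infinity (h : R -> R) (C : R) :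
  strictly_convex_on (fun x => 0 < x) h ->
  (forall x, 0 < x -> h x <= C - ln x) ->
  strictly_decreasing_on (fun x => 0 < x) h.
Proof.
  intros Hc Hb x y Hx Hy Hxy.
  destruct (Rlt_or_le (h y) (h x)) as [|Hle]; [assumption|exfalso].
  (* Beyond [exp (C - h y)] the upper bound drops below [h y]. *)
  set (z := y + exp (C - h y)).
  assert (He : 0 < exp (C - h y)) by apply exp_pos.
  assert (Hz : h z < h y).
  { assert (ln (exp (C - h y)) < ln z) by (apply ln_increasing; unfold z; lra).
    rewrite ln_exp in H.
    specialize (Hb z ltac:(unfold z; lra)). lra. }
  assert (Hyz : y < z) by (unfold z; lra).
  clearbody z.
  set (t := (z - y) / (z - x)).
  assert (Ht : 0 < t < 1).
  { unfold t. split; [apply Rdiv_lt_0_compat; lra|].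
    apply (Rmult_lt_reg_r (z - x)); [lra|].
    unfold Rdiv. rewrite Rmult_assoc, Rinv_l; lra. }
  assert (H := Hc x z t Hx ltac:(lra) ltac:(lra) Ht).
  replace (t * x + (1 - t) * z) with y in H by (unfold t; field; lra).
  nra.
Qed.

(** A pointwise limit of strictly convex functions is only convex; the fixed
    summand [e] carries strictness through the limit. *)
Lemma strictly_convex_of_limit (h e : R -> R) (A : nat -> R -> R) :
  (forall N, strictly_convex_on (fun x => 0 < x) (A N)) ->
  strictly_convex_on (fun x => 0 < x) e ->
  (forall x, 0 < x -> is_lim_seq (fun N => A N x) (h x - e x)) ->
  strictly_convex_on (fun x => 0 < x) h.
Proof.
  intros HA He Hl x y t Hx Hy Hne Ht.
  assert (Hz : 0 < t * x + (1 - t) * y) by nra.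
  assert (H : h (t * x + (1 - t) * y) - e (t * x + (1 - t) * y)
    <= t * (h x - e x) + (1 - t) * (h y - e y)).
  { apply (is_lim_seq_le (fun N => A N (t * x + (1 - t) * y))
             (fun N => t * A N x + (1 - t) * A N y)
             (h (t * x + (1 - t) * y) - e (t * x + (1 - t) * y))
             (t * (h x - e x) + (1 - t) * (h y - e y))).
    - intros N. apply Rlt_le, HA; assumption.
    - auto.
    - apply is_lim_seq_plus'.
      + apply (is_lim_seq_scal_l _ t (h x - e x)); auto.
      + apply (is_lim_seq_scal_l _ (1 - t) (h y - e y)); auto. }
  specialize (He x y t Hx Hy Hne Ht). lra.
Qed.

(** * An estimate for each factor of the product *)

(** This is [cosh v <= (sinh v / v) ^ 3] for [u = 2 * v], written with [exp u].
    Taking cube roots makes it [u <= (exp u - 1) * w u] with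
    [w u ^ 3 = 2 / (exp u * (exp u + 1))].  Both sides vanish at [0], and the
    derivative of the right-hand side is at least [1] by the inequality of
    arithmetic and geometric means. *)
Lemma Lazarevic_inequality (u : R) : 0 <= u ->
  u ^ 3 * (exp u * (exp u + 1)) <= 2 * (exp u - 1) ^ 3.
Proof.
  intros Hu.
  set (w := fun s => exp ((ln 2 - s - ln (exp s + 1)) / 3)).
  assert (w3 : forall s, w s ^ 3 * (exp s * (exp s + 1)) = 2).
  { intros s. assert (He := exp_pos s). unfold w. simpl pow. rewrite Rmult_1_r, <- !exp_plus.
    replace (_ + (_ + _)) with (ln 2 + (- s + - ln (exp s + 1))) by field.
    rewrite !exp_plus, !exp_Ropp, !exp_ln by lra. field. lra. }
  assert (wpos : forall s, 0 < w s) by (intros; apply exp_pos).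
  set (B := fun s => (exp s ^ 2 + 4 * exp s + 1) / (3 * (exp s + 1))).
  assert (D : forall s, is_derive (fun s => (exp s - 1) * w s - s) s (w s * B s - 1)).
  { intros s. assert (He := exp_pos s). unfold w, B. auto_derive; [lra|].
    unfold Rminus, Rdiv. field. lra. }
  assert (Bw : forall s, 1 <= w s * B s).
  { intros s. assert (He := exp_pos s). assert (Hw := wpos s).
    assert (HB : 0 < B s) by (unfold B; apply Rdiv_lt_0_compat; nra).
    assert (H3 : 1 <= (w s * B s) ^ 3).
    { assert (Heq : (w s * B s) ^ 3 * (27 * (exp s * (exp s + 1) ^ 4))
        = 2 * (exp s ^ 2 + 4 * exp s + 1) ^ 3).
      { rewrite <- (w3 s) at 1. unfold B. field. lra. }
      assert (Ham : 27 * (exp s * (exp s + 1) ^ 4) <= 2 * (exp s ^ 2 + 4 * exp s + 1) ^ 3).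
      { set (E := exp s) in *.
        (* With [a = (E + 1) ^ 2] and [b = 2 * E], the difference is
           [4 * (a + b) ^ 3 - 27 * a ^ 2 * b = (a - 2 * b) ^ 2 * (4 * a + b)]
           up to a factor [2]. *)
        assert (0 <= ((E + 1) ^ 2 - 4 * E) ^ 2 * (4 * (E + 1) ^ 2 + 2 * E)).
        { apply Rmult_le_pos; [apply pow2_ge_0|nra]. }
        nra. }
      assert (0 < 27 * (exp s * (exp s + 1) ^ 4)).
      { apply Rmult_lt_0_compat; [lra|]. apply Rmult_lt_0_compat; [lra|]. apply pow_lt; lra. }
      apply (Rmult_le_reg_r (27 * (exp s * (exp s + 1) ^ 4))); lra. }
    destruct (Rle_or_lt 1 (w s * B s)) as [|Hlt]; [assumption|].
    assert (Hk : 0 < w s * B s) by nra. generalize dependent (w s * B s). intros k. intros.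
    assert (k * k < 1) by nra. simpl in *. nra. }
  assert (Hle : u <= (exp u - 1) * w u).
  { destruct (Req_dec u 0) as [->|Hne]; [rewrite exp_0; lra|].
    destruct (MVT_cor2 (fun s => (exp s - 1) * w s - s) (fun s => w s * B s - 1) 0 u)
      as [c [Hc _]]; [lra| |].
    { intros c _. apply is_derive_Reals, D. }
    specialize (Bw c). rewrite exp_0 in Hc. nra. }
  assert (Hc : u ^ 3 <= ((exp u - 1) * w u) ^ 3) by (apply pow_incr; lra).
  assert (He := exp_pos u).
  apply Rle_trans with (((exp u - 1) * w u) ^ 3 * (exp u * (exp u + 1))).
  - apply Rmult_le_compat_r; nra.
  - rewrite Rpow_mult_distr, Rmult_assoc, w3. lra.
Qed.

Lemma ln_lt_0 (q : R) : 0 < q < 1 -> ln q < 0.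
Proof. intros hq. rewrite <- ln_1. apply ln_increasing; lra. Qed.

Lemma Rpower_lt_1 (q a : R) : 0 < q < 1 -> 0 < a -> Rpower q a < 1.
Proof.
  intros hq Ha. assert (H := ln_lt_0 q hq).
  rewrite <- exp_0. apply exp_increasing. nra.
Qed.

(** The right-hand side is the third derivative of [- ln (1 - Rpower q a)]
    in [a], and the left-hand side that of [- ln a], its limit as [q] tends to [1]
    up to an additive constant. *)
Lemma third_derivative_bound (q a : R) : 0 < q < 1 -> 0 < a ->
  - (2 / a ^ 3)
  <= ln q ^ 3 * (Rpower q a * (1 + Rpower q a)) / (1 - Rpower q a) ^ 3.
Proof.
  intros hq Ha. unfold Rpower.
  assert (HL := ln_lt_0 q hq). set (L := ln q) in *. clearbody L.
  set (u := - (a * L)). assert (Hu : 0 < u) by (unfold u; nra).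
  assert (HE : 1 < exp u) by (rewrite <- exp_0; apply exp_increasing; assumption).
  assert (H := Lazarevic_inequality u (Rlt_le _ _ Hu)).
  replace (exp (a * L)) with (/ exp u) by (rewrite <- exp_Ropp; f_equal; unfold u; ring).
  replace L with (- u / a) by (unfold u; field; lra).
  set (E := exp u) in *. clearbody u E.
  replace ((- u / a) ^ 3 * (/ E * (1 + / E)) / (1 - / E) ^ 3)
    with (- ((u ^ 3 * (E * (E + 1)) / (E - 1) ^ 3) / a ^ 3)) by (field; lra).
  apply Ropp_le_contravar. apply Rmult_le_compat_r.
  - apply Rlt_le, Rinv_0_lt_compat, pow_lt; assumption.
  - assert (0 < (E - 1) ^ 3) by (apply pow_lt; lra).
    apply (Rmult_le_reg_r ((E - 1) ^ 3)); [assumption|].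
    unfold Rdiv. rewrite Rmult_assoc, Rinv_l; lra.
Qed.

(** By convexity, each [2 / m ^ 3] is at most the integral of [2 / s ^ 3] over the
    unit interval centred at [m], and these intervals are adjacent. *)
Lemma sum_inverse_cubes_bound (x : R) (N : nat) : 0 < x ->
  sum_f_R0 (fun i => 2 / (x + INR (S i)) ^ 3) N
  <= / (x + 1 / 2) ^ 2 - / (x + INR (S N) + 1 / 2) ^ 2.
Proof.
  intros Hx.
  assert (step : forall m, 1 / 2 < m ->
    2 / m ^ 3 <= / (m - 1 / 2) ^ 2 - / (m + 1 / 2) ^ 2).
  { intros m Hm.
    assert (Hp : 0 < (m - 1 / 2) ^ 2 * (m + 1 / 2) ^ 2 * m ^ 3)
      by (repeat apply Rmult_lt_0_compat; try lra; apply pow_lt; lra).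
    apply Rminus_le_0.
    replace (/ (m - 1 / 2) ^ 2 - / (m + 1 / 2) ^ 2 - 2 / m ^ 3)
      with ((m ^ 2 - 1 / 8) / ((m - 1 / 2) ^ 2 * (m + 1 / 2) ^ 2 * m ^ 3)) by (field; lra).
    apply Rlt_le, Rdiv_lt_0_compat; nra. }
  induction N as [|N IH].
  - simpl sum_f_R0.
    eapply Rle_trans; [apply step|].
    { simpl; lra. }
    right. simpl INR. f_equal; f_equal; f_equal; lra.
  - rewrite tech5.
    assert (HN := pos_INR (S N)).
    eapply Rle_trans; [apply Rplus_le_compat; [apply IH|apply step]|].
    { rewrite S_INR. lra. }
    right. rewrite (S_INR (S N)).
    replace (x + (INR (S N) + 1) - 1 / 2) with (x + INR (S N) + 1 / 2) by lra. ring.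
Qed.

(** * The logarithm of the q-gamma function *)

(** The limit of the partial products could a priori be [0].  The bound
    [- ln (1 - t) <= t / (1 - t)] makes the series of logarithms converge
    geometrically, so that the product is the exponential of its sum. *)
Lemma ln_q_pochhammer_inf (q a : R) : 0 < q < 1 -> 0 <= a < 1 ->
  0 < q_pochhammer_inf a q /\
  is_lim_seq (sum_f_R0 (fun i => ln (1 - a * q ^ i))) (ln (q_pochhammer_inf a q)).
Proof.
  intros hq Ha.
  assert (Hqi : forall i, 0 < q ^ i <= 1).
  { intros i. split; [apply pow_lt; lra|]. rewrite <- (pow1 i). apply pow_incr. lra. }
  assert (Hs : ex_series (fun i => ln (1 - a * q ^ i))).
  { apply (@ex_series_le R_AbsRing R_CompleteNormedModule _ (fun i => / (1 - a) * q ^ i)).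
    - intros i. destruct (Hqi i) as [H1 H2].
      assert (Ht : 0 <= a * q ^ i <= a) by nra.
      assert (Hta : a * q ^ i <= q ^ i) by nra.
      change (Rabs (ln (1 - a * q ^ i)) <= / (1 - a) * q ^ i).
      set (t := a * q ^ i) in *.
      rewrite Rabs_left1.
      + rewrite <- ln_Rinv by lra.
        apply Rle_trans with (t / (1 - t)).
        * assert (H := exp_ineq1_le (t / (1 - t))).
          replace (1 + t / (1 - t)) with (/ (1 - t)) in H by (field; lra).
          rewrite <- (ln_exp (t / (1 - t))).
          apply ln_le; [apply Rinv_0_lt_compat; lra | assumption].
        * unfold Rdiv. rewrite Rmult_comm. apply Rmult_le_compat; try lra.
          -- apply Rlt_le, Rinv_0_lt_compat; lra.
          -- apply Rinv_le_contravar; lra.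
      + rewrite <- ln_1. apply ln_le; lra.
    - apply (@ex_series_scal_l R_AbsRing). apply ex_series_geom.
      rewrite Rabs_pos_eq; lra. }
  destruct Hs as [l Hl].
  assert (Hl' : is_lim_seq (sum_f_R0 (fun i => ln (1 - a * q ^ i))) l).
  { apply is_lim_seq_ext with (sum_n (fun i => ln (1 - a * q ^ i))); [apply sum_n_Reals|].
    exact Hl. }
  assert (Hp : forall n, prod_f_R0 (fun i => 1 - a * q ^ i) n
    = exp (sum_f_R0 (fun i => ln (1 - a * q ^ i)) n)).
  { assert (Hpos : forall i, 0 < 1 - a * q ^ i) by (intros i; specialize (Hqi i); nra).
    induction n as [|n IH].
    - simpl. rewrite exp_ln; [reflexivity|apply (Hpos 0%nat)].
    - change (prod_f_R0 (fun i => 1 - a * q ^ i) n * (1 - a * q ^ S n)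
        = exp (sum_f_R0 (fun i => ln (1 - a * q ^ i)) (S n))).
      rewrite tech5, exp_plus, IH, exp_ln by apply Hpos. reflexivity. }
  assert (Hv : q_pochhammer_inf a q = exp l).
  { unfold q_pochhammer_inf.
    rewrite (is_lim_seq_unique _ (exp l)); [reflexivity|].
    apply is_lim_seq_ext with (fun n => exp (sum_f_R0 (fun i => ln (1 - a * q ^ i)) n)).
    { intros n. symmetry. apply Hp. }
    apply is_lim_seq_continuous; [|assumption].
    apply derivable_continuous_pt, derivable_pt_exp. }
  rewrite Hv. split; [apply exp_pos|]. rewrite ln_exp. assumption.
Qed.

Definition log_term (q m x : R) : R :=
  ln (1 - Rpower q m) - ln (1 - Rpower q (x + m)).

(** The logarithm of [q_Gamma q (x + 1)] with both infinite products cut after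
    the factor of index [N]; the factor of index [i] of the product
    [q_pochhammer_inf (Rpower q (x + 1)) q] is [1 - Rpower q (x + INR (S i))]. *)
Definition log_q_Gamma_partial (q : R) (N : nat) (x : R) : R :=
  sum_f_R0 (fun i => log_term q (INR (S i)) x) N - x * ln (1 - q).

Lemma log_q_Gamma_limit (q x : R) : 0 < q < 1 -> 0 <= x ->
  is_lim_seq (fun N => log_q_Gamma_partial q N x) (ln (q_Gamma q (x + 1))).
Proof.
  intros hq Hx.
  assert (Hr : 0 <= Rpower q (x + 1) < 1).
  { split; [apply Rlt_le, exp_pos|]. apply Rpower_lt_1; lra. }
  assert (Hq : 0 <= q < 1) by lra.
  destruct (ln_q_pochhammer_inf q q hq Hq) as [P1 L1].
  destruct (ln_q_pochhammer_inf q _ hq Hr) as [P2 L2].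
  assert (P3 : 0 < Rpower (1 - q) (1 - (x + 1))) by apply exp_pos.
  assert (Hd := Rdiv_lt_0_compat _ _ P1 P2).
  unfold q_Gamma. rewrite ln_mult, ln_div by assumption.
  replace (ln (Rpower (1 - q) (1 - (x + 1)))) with (- (x * ln (1 - q)))
    by (unfold Rpower; rewrite ln_exp; ring).
  apply is_lim_seq_ext with (fun N => (sum_f_R0 (fun i => ln (1 - q * q ^ i)) N
     - sum_f_R0 (fun i => ln (1 - Rpower q (x + 1) * q ^ i)) N) + - (x * ln (1 - q))).
  - intros N. unfold log_q_Gamma_partial. apply Rplus_eq_compat_r.
    rewrite <- minus_sum. apply sum_eq. intros i _. unfold log_term.
    replace (x + INR (S i)) with (x + 1 + INR i) by (rewrite S_INR; ring).
    rewrite (Rpower_plus (x + 1)), !Rpower_pow by lra. reflexivity.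
  - apply is_lim_seq_plus'; [apply is_lim_seq_minus'; assumption|apply is_lim_seq_const].
Qed.

Lemma log_term_le_0 (q m x : R) : 0 < q < 1 -> 0 < m -> 0 <= x -> log_term q m x <= 0.
Proof.
  intros hq Hm Hx.
  assert (HL := ln_lt_0 q hq).
  assert (H1 : Rpower q (x + m) <= Rpower q m).
  { destruct (Req_dec x 0) as [->|Hne]; [rewrite Rplus_0_l; lra|].
    apply Rlt_le, exp_increasing. nra. }
  assert (H2 : Rpower q m < 1) by (apply Rpower_lt_1; assumption).
  assert (ln (1 - Rpower q m) <= ln (1 - Rpower q (x + m))) by (apply ln_le; lra).
  unfold log_term. lra.
Qed.

Lemma log_q_Gamma_upper (q x : R) : 0 < q < 1 -> 0 <= x ->
  ln (q_Gamma q (x + 1)) <= - (x * ln (1 - q)).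
Proof.
  intros hq Hx.
  apply (is_lim_seq_le (fun N => log_q_Gamma_partial q N x) (fun _ => - (x * ln (1 - q)))
    (ln (q_Gamma q (x + 1))) (- (x * ln (1 - q))));
    [|apply log_q_Gamma_limit; assumption|apply is_lim_seq_const].
  intros N. unfold log_q_Gamma_partial.
  assert (sum_f_R0 (fun i => log_term q (INR (S i)) x) N <= 0); [|lra].
  replace 0 with (sum_f_R0 (fun _ => 0) N) by (rewrite sum_cte; ring).
  apply sum_Rle. intros i _.
  apply log_term_le_0; try assumption. apply lt_0_INR, Nat.lt_0_succ.
Qed.

(** * Strict convexity of the corrected partial sums *)

Lemma is_derive_sum_f_R0 (f : nat -> R -> R) (d : nat -> R) (N : nat) (x : R) :
  (forall i, is_derive (f i) x (d i)) ->
  is_derive (fun y => sum_f_R0 (fun i => f i y) N) x (sum_f_R0 d N).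
Proof.
  intros H. induction N as [|N IH]; simpl; [apply H|].
  apply (is_derive_plus (fun y => sum_f_R0 (fun i => f i y) N) (f (S N))); auto.
Qed.

Lemma log_term_derivatives (q m x : R) : 0 < q < 1 -> 0 < m -> 0 <= x ->
  is_derive (log_term q m) x
    (ln q * Rpower q (x + m) / (1 - Rpower q (x + m))) /\
  is_derive (fun y => ln q * Rpower q (y + m) / (1 - Rpower q (y + m))) x
    (ln q ^ 2 * Rpower q (x + m) / (1 - Rpower q (x + m)) ^ 2) /\
  is_derive (fun y => ln q ^ 2 * Rpower q (y + m) / (1 - Rpower q (y + m)) ^ 2) x
    (ln q ^ 3 * (Rpower q (x + m) * (1 + Rpower q (x + m)))
      / (1 - Rpower q (x + m)) ^ 3).
Proof.
  intros hq Hm Hx.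
  assert (H : 0 < 1 - Rpower q (x + m))
    by (apply Rlt_0_minus, Rpower_lt_1; lra).
  unfold log_term, Rpower in *.
  split; [|split]; auto_derive; try lra; try nra; field; lra.
Qed.

(** The constant [1 / 4] is small enough for
    [1 / (x + 1/2) ^ 2 + (ln (1 + x) / 4)''' < 1 / x ^ 2] to hold for every
    [x > 0], including large [x], where the gap shrinks like [1 / x ^ 3]. *)
Lemma log_q_Gamma_partial_convex (q : R) (N : nat) : 0 < q < 1 ->
  strictly_convex_on (fun x => 0 < x)
    (fun x => (log_q_Gamma_partial q N x - ln (1 + x) / 4) / x - 1 * ln x).
Proof.
  intros hq.
  assert (Hi : forall i, 0 < INR (S i)) by (intros i; apply lt_0_INR, Nat.lt_0_succ).
  set (T1 := fun i y => ln q * Rpower q (y + INR (S i)) / (1 - Rpower q (y + INR (S i)))).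
  set (T2 := fun i y =>
    ln q ^ 2 * Rpower q (y + INR (S i)) / (1 - Rpower q (y + INR (S i))) ^ 2).
  set (T3 := fun i y =>
    ln q ^ 3 * (Rpower q (y + INR (S i)) * (1 + Rpower q (y + INR (S i))))
      / (1 - Rpower q (y + INR (S i))) ^ 3).
  set (S0 := fun y => sum_f_R0 (fun i => log_term q (INR (S i)) y) N).
  set (S1 := fun y => sum_f_R0 (fun i => T1 i y) N).
  set (S2 := fun y => sum_f_R0 (fun i => T2 i y) N).
  set (S3 := fun y => sum_f_R0 (fun i => T3 i y) N).
  assert (D0 : forall x, 0 <= x -> is_derive S0 x (S1 x)).
  { intros x Hx. apply is_derive_sum_f_R0. intros i.
    apply (log_term_derivatives q (INR (S i)) x hq (Hi i) Hx). }
  assert (D1 : forall x, 0 <= x -> is_derive S1 x (S2 x)).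
  { intros x Hx. apply is_derive_sum_f_R0. intros i.
    apply (log_term_derivatives q (INR (S i)) x hq (Hi i) Hx). }
  assert (D2 : forall x, 0 <= x -> is_derive S2 x (S3 x)).
  { intros x Hx. apply is_derive_sum_f_R0. intros i.
    apply (log_term_derivatives q (INR (S i)) x hq (Hi i) Hx). }
  apply strictly_convex_quotient with
    (G1 := fun x => S1 x - ln (1 - q) - / (1 + x) / 4)
    (G2 := fun x => S2 x + / (1 + x) ^ 2 / 4)
    (G3 := fun x => S3 x - 2 / (1 + x) ^ 3 / 4).
  - intros x Hx. unfold log_q_Gamma_partial. fold (S0 x).
    apply (is_derive_minus (fun x => S0 x - x * ln (1 - q)) (fun x => ln (1 + x) / 4)).
    + apply (is_derive_minus S0 (fun x => x * ln (1 - q))); [auto|].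
      auto_derive; [trivial|ring].
    + auto_derive; [lra|field; lra].
  - intros x Hx. replace (S2 x + / (1 + x) ^ 2 / 4)
      with (S2 x - 0 - - / (1 + x) ^ 2 / 4) by (field; lra).
    apply (is_derive_minus (fun x => S1 x - ln (1 - q)) (fun x => / (1 + x) / 4)).
    + apply (is_derive_minus S1 (fun x => ln (1 - q))); [auto|].
      auto_derive; trivial.
    + auto_derive; [lra|field; lra].
  - intros x Hx.
    apply (is_derive_plus S2 (fun x => / (1 + x) ^ 2 / 4) x (S3 x)); [auto|].
    unfold opp; simpl. auto_derive; [nra|field; lra].
  - unfold log_q_Gamma_partial.
    replace (sum_f_R0 (fun i => log_term q (INR (S i)) 0) N) with (sum_f_R0 (fun _ => 0) N).
    + rewrite sum_cte, Rplus_0_r, ln_1. field.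
    + apply sum_eq. intros i _. unfold log_term. rewrite Rplus_0_l. ring.
  - intros x Hx.
    assert (Hs : - / (x + 1 / 2) ^ 2 <= S3 x).
    { apply Rle_trans with (- sum_f_R0 (fun i => 2 / (x + INR (S i)) ^ 3) N).
      - apply Ropp_le_contravar. eapply Rle_trans; [apply sum_inverse_cubes_bound; assumption|].
        assert (0 < / (x + INR (S N) + 1 / 2) ^ 2); [|lra].
        apply Rinv_0_lt_compat, pow_lt. assert (Hn := pos_INR (S N)). lra.
      - replace (- sum_f_R0 (fun i => 2 / (x + INR (S i)) ^ 3) N)
          with (-1 * sum_f_R0 (fun i => 2 / (x + INR (S i)) ^ 3) N) by ring.
        rewrite scal_sum. apply sum_Rle. intros i _. specialize (Hi i).
        eapply Rle_trans; [|apply third_derivative_bound; lra]. lra. }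
    assert (Hm : 0 < x ^ 2 * (- / (x + 1 / 2) ^ 2 - 2 / (1 + x) ^ 3 / 4) + 1).
    { replace (x ^ 2 * (- / (x + 1 / 2) ^ 2 - 2 / (1 + x) ^ 3 / 4) + 1)
        with ((2 * (x + 1 / 4) * (1 + x) ^ 3 - x ^ 2 * (x + 1 / 2) ^ 2)
          / (2 * (x + 1 / 2) ^ 2 * (1 + x) ^ 3)) by (field; lra).
      assert (0 < (x + 1 / 2) ^ 2) by (apply pow_lt; lra).
      assert (0 < (1 + x) ^ 3) by (apply pow_lt; lra).
      apply Rdiv_lt_0_compat; [|nra].
      assert (0 < x ^ 2) by (apply pow_lt; lra).
      assert (0 < x ^ 3) by (apply pow_lt; lra).
      assert (0 < x ^ 4) by (apply pow_lt; lra). nra. }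
    assert (0 < x ^ 2) by (apply pow_lt; lra). nra.
Qed.

Lemma ln_1p_quotient_convex :
  strictly_convex_on (fun x => 0 < x) (fun x => ln (1 + x) / 4 / x - 0 * ln x).
Proof.
  apply strictly_convex_quotient with (G1 := fun x => / (1 + x) / 4)
    (G2 := fun x => - / (1 + x) ^ 2 / 4) (G3 := fun x => 2 / (1 + x) ^ 3 / 4).
  - intros x Hx. auto_derive; [lra|field; lra].
  - intros x Hx. auto_derive; [lra|field; lra].
  - intros x Hx. auto_derive; [nra|field; lra].
  - rewrite Rplus_0_r, ln_1. field.
  - intros x Hx. rewrite Rplus_0_r.
    apply Rmult_lt_0_compat; [apply pow_lt; lra|].
    apply Rdiv_lt_0_compat; [|lra]. apply Rdiv_lt_0_compat; [lra|apply pow_lt; lra].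
Qed.

(** * Decrease and log-convexity *)

Theorem theorem5 (q : R) (hq : 0 < q < 1) :
  let f := fun x : R => Rpower (q_Gamma q (x + 1)) (1 / x) in
  let F := fun x : R => f x / x in
  strictly_decreasing_on (fun x : R => 0 < x) F /\
  strictly_log_convex_on (fun x : R => 0 < x) F.
Proof.
  intros f F.
  assert (Fpos : forall x, 0 < x -> 0 < F x).
  { intros x Hx. apply Rdiv_lt_0_compat; [apply exp_pos|assumption]. }
  assert (lnF : forall x, 0 < x -> ln (F x) = ln (q_Gamma q (x + 1)) / x - ln x).
  { intros x Hx. unfold F. rewrite ln_div; [|apply exp_pos|assumption].
    unfold f, Rpower. rewrite ln_exp. field. lra. }
  assert (conv : strictly_convex_on (fun x => 0 < x) (fun x => ln (F x))).
  { apply (strictly_convex_of_limit _ _ _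
      (fun N => log_q_Gamma_partial_convex q N hq) ln_1p_quotient_convex).
    intros x Hx. rewrite (lnF x Hx).
    assert (Hl := log_q_Gamma_limit q x hq (Rlt_le _ _ Hx)).
    apply is_lim_seq_ext with
      (fun N => / x * log_q_Gamma_partial q N x + (- (ln (1 + x) / 4 / x) - ln x)).
    { intros N. field. lra. }
    replace (ln (q_Gamma q (x + 1)) / x - ln x - (ln (1 + x) / 4 / x - 0 * ln x))
      with (/ x * ln (q_Gamma q (x + 1)) + (- (ln (1 + x) / 4 / x) - ln x)) by (field; lra).
    apply is_lim_seq_plus'; [|apply is_lim_seq_const].
    apply (is_lim_seq_scal_l _ (/ x) (ln (q_Gamma q (x + 1)))). assumption. }
  split; [|split; assumption].
  intros x y Hx Hy Hxy. apply ln_lt_inv; auto.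
  apply (strictly_decreasing_of_convex_to_minus_infinity (fun x => ln (F x)) (- ln (1 - q)));
    auto.
  intros z Hz. rewrite (lnF z Hz).
  assert (H := log_q_Gamma_upper q z hq (Rlt_le _ _ Hz)).
  assert (ln (q_Gamma q (z + 1)) / z <= - ln (1 - q)); [|lra].
  apply (Rmult_le_reg_r z); [assumption|].
  unfold Rdiv. rewrite Rmult_assoc, Rinv_l; lra.
Qed.
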